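(* Let $U\colon\mathcal{C}\to\mathcal{X}$ and $V\colon\mathcal{D}\to\mathcal{Y}$ be opfibrations and let $(K,F)\colon U\to V$ be an opfibred 1-cell, with $K\colon\mathcal{C}\to\mathcal{D}$ and $F\colon\mathcal{X}\to\mathcal{Y}$. Suppose $F$ has a right adjoint $G$ with counit $\varepsilon\colon FG\Rightarrow 1_{\mathcal{Y}}$. Then the following are equivalent: (1) $K$ has a right adjoint $R$ such that: (i) $UR(D)=GV(D)$ for all $D\in\mathcal{D}$; (ii) the counit $e\colon KR\Rightarrow 1_{\mathcal{D}}$ satisfies $Ve=\varepsilon V$. (2) For all $Y\in\mathcal{Y}$, the functor $\mathcal{C}_{G(Y)}\xrightarrow{K}\mathcal{D}_{FG(Y)}\xrightarrow{(\varepsilon_Y)_!}\mathcal{D}_Y$ has a right adjoint $R_Y$. In this case: (a) $R_Y$ is, up to unique isomorphism, the restriction of $R$ to fibres. (b) For $D\in\mathcal{D}_Y$, $e_D=u_D\circ\tilde\varepsilon_D$, where $\tilde\varepsilon_D\colon KR_Y(D)\to(\varepsilon_Y)_!KR_Y(D)$ is the cocartesian lifting of $\varepsilon_Y$, and $e_D$ and $u_D$ are the components of the counits of $K\dashv R$ and $(\varepsilon_Y)_!K\dashv R_Y$, respectively. (c) $(K,F)\dashv(R,G)$ in $\mathsf{Cat}^{\mathbb{2}}$.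
   Context: All opfibrations are cloven (equipped with chosen cocartesian liftings). The fibre $\mathcal{C}_X$ of $U\colon\mathcal{C}\to\mathcal{X}$ over $X$ is the subcategory of morphisms sent by $U$ to $1_X$. For $f\colon Y'\to Y$ in the base of $V$, $f_!\colon\mathcal{D}_{Y'}\to\mathcal{D}_Y$ is the reindexing functor sending an object to the codomain of the chosen cocartesian lifting of $f$. An opfibred 1-cell $(K,F)\colon U\to V$ is a commutative square $VK=FU$ such that $K$ preserves cocartesian morphisms; it restricts to functors $\mathcal{C}_X\to\mathcal{D}_{F(X)}$. $\mathsf{Cat}^{\mathbb{2}}$ is the 2-category of 2-functors $\mathbb{2}\to\mathsf{Cat}$, 2-natural transformations and modifications: objects are functors, 1-cells $U\to V$ are strictly commutative squares $(K,F)$ with $VK=FU$, and 2-cells are pairs of natural transformations $(\alpha,\beta)$ with $V\alpha=\beta U$. *)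

(* Defs.v *)
(* Categories are strict: equality of objects and of arrows is Leibniz equality
   (hom-types are sets, by proof irrelevance). *)
From Stdlib Require Import Classical ClassicalEpsilon.

Set Implicit Arguments.
Unset Strict Implicit.
Unset Printing Implicit Defensive.

Declare Scope cat_scope.
Delimit Scope cat_scope with cat.
Local Open Scope cat_scope.

Record Category := {
  ob :> Type;
  hom : ob -> ob -> Type;
  id : forall A, hom A A;
  comp : forall {A B C}, hom B C -> hom A B -> hom A C;
  comp_id_l : forall A B (f : hom A B), comp (id B) f = f;
  comp_id_r : forall A B (f : hom A B), comp f (id A) = f;
  comp_assoc : forall A B C D (h : hom C D) (g : hom B C) (f : hom A B),
    comp h (comp g f) = comp (comp h g) f }.
Arguments hom {c} A B.
Arguments id {c} A.
Arguments comp {c A B C} g f.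

Notation "g ∘ f" := (comp g f) (at level 40, left associativity) : cat_scope.

(* Equality of two arrows whose (co)domains are not syntactically the same:
   it holds iff domains, codomains and the arrows themselves are all equal. *)
Inductive hom_eq {C : Category} {A B : C} (f : hom A B) :
    forall {A' B' : C}, hom A' B' -> Prop :=
  | hom_eq_refl : hom_eq f f.

Definition is_iso {C : Category} {A B : C} (f : hom A B) : Prop :=
  exists g : hom B A, g ∘ f = id A /\ f ∘ g = id B.

Record Functor (C D : Category) := {
  fobj :> C -> D;
  fmap : forall {A B : C}, hom A B -> hom (fobj A) (fobj B);
  fmap_id : forall A : C, fmap (id A) = id (fobj A);
  fmap_comp : forall (A B B' : C) (g : hom B B') (f : hom A B),
    fmap (g ∘ f) = fmap g ∘ fmap f }.
Arguments fmap {C D} f {A B} _ : rename.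

Definition id_functor (C : Category) : Functor C C.
Proof. refine {| fobj := fun A => A; fmap := fun A B f => f |}; reflexivity. Defined.

Definition comp_functor {C D E : Category} (G : Functor D E) (F : Functor C D) :
  Functor C E.
Proof.
  refine {| fobj := fun A => G (F A); fmap := fun A B f => fmap G (fmap F f) |}.
  - intros A. now rewrite !fmap_id.
  - intros. now rewrite !fmap_comp.
Defined.

Record NatTrans {C D : Category} (F G : Functor C D) := {
  component :> forall A : C, hom (F A) (G A);
  naturality : forall (A B : C) (f : hom A B),
    component B ∘ fmap F f = fmap G f ∘ component A }.

Definition is_nat_iso {C D : Category} {F G : Functor C D} (t : NatTrans F G) : Prop :=
  forall A, is_iso (t A).

Record Adjunction {C D : Category} (L : Functor C D) (R : Functor D C) := {
  unit : NatTrans (id_functor C) (comp_functor R L);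
  counit : NatTrans (comp_functor L R) (id_functor D);
  triangle_l : forall A : C, counit (L A) ∘ fmap L (unit A) = id (L A);
  triangle_r : forall B : D, fmap R (counit B) ∘ unit (R B) = id (R B) }.

(* [t] is an isomorphism between two right adjoints of [L] which respects the
   counits (equivalently, the units). *)
Definition right_adjoint_iso {C D : Category} {L : Functor C D} {R R' : Functor D C}
    (a : Adjunction L R) (a' : Adjunction L R') (t : NatTrans R R') : Prop :=
  is_nat_iso t /\ forall B : D, counit a' B ∘ fmap L (t B) = counit a B.

Lemma hom_eq_eq {C : Category} {A B : C} (f g : hom A B) : hom_eq f g -> f = g.
Proof.
  intros H.
  assert (E : existT (fun A => {B : C & hom A B}) A (existT _ B f) =
              existT (fun A => {B : C & hom A B}) A (existT _ B g)).
  { now destruct H. }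
  now do 2 apply inj_pairT2 in E.
Qed.

Lemma hom_eq_sym {C : Category} {A B A' B' : C} (f : hom A B) (g : hom A' B') :
  hom_eq f g -> hom_eq g f.
Proof. now intros []. Qed.

Lemma hom_eq_trans {C : Category} {A B A' B' A'' B'' : C}
    (f : hom A B) (g : hom A' B') (h : hom A'' B'') :
  hom_eq f g -> hom_eq g h -> hom_eq f h.
Proof. now intros [] []. Qed.

Lemma hom_eq_of_eq {C : Category} {A B : C} (f g : hom A B) : f = g -> hom_eq f g.
Proof. now intros []. Qed.

Lemma hom_eq_id {C : Category} {A A' : C} : A = A' -> hom_eq (id A) (id A').
Proof. now intros []. Qed.

Lemma hom_eq_fmap {C D : Category} (F : Functor C D) {A B A' B' : C}
    (f : hom A B) (g : hom A' B') :
  hom_eq f g -> hom_eq (fmap F f) (fmap F g).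
Proof. now intros []. Qed.

Lemma hom_eq_functor {C D : Category} (F G : Functor C D) {A B : C} (f : hom A B) :
  F = G -> hom_eq (fmap F f) (fmap G f).
Proof. now intros []. Qed.

Lemma hom_eq_comp {C : Category} {A1 B1 C1 A2 B2 C2 : C}
    (g1 : hom B1 C1) (f1 : hom A1 B1) (g2 : hom B2 C2) (f2 : hom A2 B2) :
  A1 = A2 -> B1 = B2 -> C1 = C2 -> hom_eq g1 g2 -> hom_eq f1 f2 ->
  hom_eq (g1 ∘ f1) (g2 ∘ f2).
Proof.
  intros <- <- <- Hg Hf. now rewrite (hom_eq_eq Hg), (hom_eq_eq Hf).
Qed.

Lemma hom_eq_cast {C : Category} {A B A' B' : C} (f : hom A B) :
  A = A' -> B = B' -> exists f' : hom A' B', hom_eq f' f.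
Proof. intros <- <-. now exists f. Qed.

Definition fibre_ob {E B : Category} (U : Functor E B) (X : B) : Type :=
  {A : E | U A = X}.

Definition fibre_hom {E B : Category} (U : Functor E B) (X : B)
    (A A' : fibre_ob U X) : Type :=
  {f : hom (proj1_sig A) (proj1_sig A') | hom_eq (fmap U f) (id X)}.

Lemma fibre_hom_ext {E B : Category} (U : Functor E B) (X : B)
    (A A' : fibre_ob U X) (f g : fibre_hom A A') :
  proj1_sig f = proj1_sig g -> f = g.
Proof.
  destruct f as [f Hf], g as [g Hg]. simpl. intros <-.
  now rewrite (proof_irrelevance _ Hf Hg).
Qed.

Definition fibre_id {E B : Category} (U : Functor E B) (X : B) (A : fibre_ob U X) :
  fibre_hom A A.
Proof.
  exists (id (proj1_sig A)). rewrite fmap_id. apply hom_eq_id. exact (proj2_sig A).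
Defined.

Definition fibre_comp {E B : Category} (U : Functor E B) (X : B)
    (A1 A2 A3 : fibre_ob U X) (g : fibre_hom A2 A3) (f : fibre_hom A1 A2) :
  fibre_hom A1 A3.
Proof.
  exists (proj1_sig g ∘ proj1_sig f).
  rewrite fmap_comp, <- (comp_id_l (id X)).
  exact (hom_eq_comp (proj2_sig A1) (proj2_sig A2) (proj2_sig A3)
    (proj2_sig g) (proj2_sig f)).
Defined.

Definition Fibre {E B : Category} (U : Functor E B) (X : B) : Category.
Proof.
  refine {| ob := fibre_ob U X; hom := @fibre_hom E B U X;
            id := @fibre_id E B U X; comp := @fibre_comp E B U X |};
    intros; apply fibre_hom_ext; simpl.
  - apply comp_id_l.
  - apply comp_id_r.
  - apply comp_assoc.
Defined.

Definition cocartesian {E B : Category} (U : Functor E B) {A A' : E} (p : hom A A') :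
    Prop :=
  forall (A'' : E) (q : hom A A'') (g : hom (U A') (U A'')),
    g ∘ fmap U p = fmap U q ->
    exists! r : hom A' A'', fmap U r = g /\ r ∘ p = q.

(* Cloven opfibrations: the cocartesian liftings are part of the structure,
   but no functoriality of the choice is assumed. *)
Record Opfibration (E B : Category) := {
  opf_functor :> Functor E B;
  push : forall {X X' : B}, hom X X' -> fibre_ob opf_functor X -> fibre_ob opf_functor X';
  lift : forall {X X' : B} (f : hom X X') (A : fibre_ob opf_functor X),
    hom (proj1_sig A) (proj1_sig (push f A));
  lift_over : forall (X X' : B) (f : hom X X') (A : fibre_ob opf_functor X),
    hom_eq (fmap opf_functor (lift f A)) f;
  lift_cocartesian : forall (X X' : B) (f : hom X X') (A : fibre_ob opf_functor X),
    cocartesian opf_functor (lift f A) }.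
Arguments push {E B} P {X X'} f A : rename.
Arguments lift {E B} P {X X'} f A : rename.

Lemma reindex_fmap_spec {E B : Category} (P : Opfibration E B) {X X' : B}
    (f : hom X X') {A A' : Fibre P X} (a : hom A A') :
  exists! b : @hom (Fibre P X') (push P f A) (push P f A'),
    proj1_sig b ∘ lift P f A = lift P f A' ∘ proj1_sig a.
Proof.
  pose proof (proj2_sig (push P f A)) as e.
  pose proof (proj2_sig (push P f A')) as e'.
  destruct (hom_eq_cast (id X') (eq_sym e) (eq_sym e')) as [g Hg].
  assert (Hq : g ∘ fmap P (lift P f A) = fmap P (lift P f A' ∘ proj1_sig a)).
  { apply hom_eq_eq. apply hom_eq_trans with (g := f).
    - apply hom_eq_trans with (g := id X' ∘ f).
      + apply hom_eq_comp; auto using lift_over. exact (proj2_sig A).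
      + rewrite comp_id_l. constructor.
    - rewrite fmap_comp. apply hom_eq_sym.
      apply hom_eq_trans with (g := f ∘ id X).
      + apply hom_eq_comp; auto using lift_over;
          first [exact (proj2_sig A) | exact (proj2_sig A') | exact (proj2_sig a)].
      + rewrite comp_id_r. constructor. }
  destruct (lift_cocartesian Hq) as [r [[Hr1 Hr2] Hu]].
  assert (Hr : hom_eq (fmap P r) (id X')) by (now rewrite Hr1).
  exists (exist _ r Hr). split; [exact Hr2|].
  intros [b Hb] Hb2. apply fibre_hom_ext. simpl in *. apply Hu. split; [|exact Hb2].
  apply hom_eq_eq, hom_eq_trans with (1 := Hb), hom_eq_sym, Hg.
Qed.

Definition reindex_fmap {E B : Category} (P : Opfibration E B) {X X' : B}
    (f : hom X X') {A A' : Fibre P X} (a : hom A A') :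
    @hom (Fibre P X') (push P f A) (push P f A') :=
  proj1_sig (constructive_definite_description _ (reindex_fmap_spec f a)).

Lemma reindex_fmapE {E B : Category} (P : Opfibration E B) {X X' : B}
    (f : hom X X') {A A' : Fibre P X} (a : hom A A') :
  proj1_sig (reindex_fmap f a) ∘ lift P f A = lift P f A' ∘ proj1_sig a.
Proof.
  exact (proj2_sig (constructive_definite_description _ (reindex_fmap_spec f a))).
Qed.

Lemma reindex_fmap_unique {E B : Category} (P : Opfibration E B) {X X' : B}
    (f : hom X X') {A A' : Fibre P X} (a : hom A A')
    (b : @hom (Fibre P X') (push P f A) (push P f A')) :
  proj1_sig b ∘ lift P f A = lift P f A' ∘ proj1_sig a -> reindex_fmap f a = b.
Proof.
  intros Hb. destruct (reindex_fmap_spec f a) as [c [_ Hc]].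
  rewrite <- (Hc _ Hb). symmetry. apply Hc, reindex_fmapE.
Qed.

Definition reindex {E B : Category} (P : Opfibration E B) {X X' : B} (f : hom X X') :
  Functor (Fibre P X) (Fibre P X').
Proof.
  refine {| fobj := push P f : Fibre P X -> Fibre P X';
            fmap := fun A A' a => reindex_fmap f a |}.
  - intros A. apply reindex_fmap_unique. simpl. now rewrite comp_id_l, comp_id_r.
  - intros A1 A2 A3 b a. apply reindex_fmap_unique. simpl.
    now rewrite <- comp_assoc, reindex_fmapE, !comp_assoc, reindex_fmapE.
Defined.

(* [Square], [SquareCell] and [SquareAdjunction] are the 1-cells, the 2-cells and
   the adjunctions of the 2-category Cat^2, whose 0-cells are functors; [upper]
   acts on total categories and [lower] on bases. *)
Record Square {C X D Y : Category} (U : Functor C X) (V : Functor D Y) := {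
  upper : Functor C D;
  lower : Functor X Y;
  square_eq : comp_functor V upper = comp_functor lower U }.

Definition id_square {C X : Category} (U : Functor C X) : Square U U.
Proof.
  refine {| upper := id_functor C; lower := id_functor X |}.
  unfold comp_functor; simpl. f_equal; apply proof_irrelevance.
Defined.

Definition comp_square {C X D Y E Z : Category}
    {U : Functor C X} {V : Functor D Y} {W : Functor E Z}
    (T : Square V W) (S : Square U V) : Square U W.
Proof.
  refine {| upper := comp_functor (upper T) (upper S);
            lower := comp_functor (lower T) (lower S) |}.
  transitivity (comp_functor (comp_functor W (upper T)) (upper S)).
  - unfold comp_functor; simpl. f_equal; apply proof_irrelevance.
  - rewrite (square_eq T).
    transitivity (comp_functor (lower T) (comp_functor V (upper S))).
    + unfold comp_functor; simpl. f_equal; apply proof_irrelevance.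
    + rewrite (square_eq S).
      unfold comp_functor; simpl. f_equal; apply proof_irrelevance.
Defined.

Record SquareCell {C X D Y : Category} {U : Functor C X} {V : Functor D Y}
    (S T : Square U V) := {
  upper_cell : NatTrans (upper S) (upper T);
  lower_cell : NatTrans (lower S) (lower T);
  cell_eq : forall A : C, hom_eq (fmap V (upper_cell A)) (lower_cell (U A)) }.

(* The triangle identities are equations between pairs of natural
   transformations, written out componentwise. *)
Record SquareAdjunction {C X D Y : Category} {U : Functor C X} {V : Functor D Y}
    (S : Square U V) (T : Square V U) := {
  sq_unit : SquareCell (id_square U) (comp_square T S);
  sq_counit : SquareCell (comp_square S T) (id_square V);
  sq_triangle_l_upper : forall A : C,
    upper_cell sq_counit (upper S A) ∘ fmap (upper S) (upper_cell sq_unit A)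
      = id (upper S A);
  sq_triangle_l_lower : forall A : X,
    lower_cell sq_counit (lower S A) ∘ fmap (lower S) (lower_cell sq_unit A)
      = id (lower S A);
  sq_triangle_r_upper : forall B : D,
    fmap (upper T) (upper_cell sq_counit B) ∘ upper_cell sq_unit (upper T B)
      = id (upper T B);
  sq_triangle_r_lower : forall B : Y,
    fmap (lower T) (lower_cell sq_counit B) ∘ lower_cell sq_unit (lower T B)
      = id (lower T B) }.

Record OpfibredCell {C X D Y : Category} (U : Opfibration C X) (V : Opfibration D Y) := {
  opf_square :> Square U V;
  opf_preserves : forall (A A' : C) (p : hom A A'),
    cocartesian U p -> cocartesian V (fmap (upper opf_square) p) }.

Definition fibre_fobj {C X D Y : Category} {U : Functor C X} {V : Functor D Y}
    (S : Square U V) (A : X) (B : Fibre U A) : Fibre V (lower S A).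
Proof.
  exists (upper S (proj1_sig B)).
  transitivity (lower S (U (proj1_sig B))).
  - exact (f_equal (fun H : Functor C Y => H (proj1_sig B)) (square_eq S)).
  - exact (f_equal (lower S) (proj2_sig B)).
Defined.

Definition fibre_fmap {C X D Y : Category} {U : Functor C X} {V : Functor D Y}
    (S : Square U V) (A : X) (B B' : Fibre U A) (f : hom B B') :
  hom (fibre_fobj S B) (fibre_fobj S B').
Proof.
  exists (fmap (upper S) (proj1_sig f)).
  apply hom_eq_trans with (g := fmap (lower S) (fmap U (proj1_sig f))).
  - exact (hom_eq_functor (proj1_sig f) (square_eq S)).
  - rewrite <- fmap_id. apply hom_eq_fmap. exact (proj2_sig f).
Defined.

(* The restriction of a 1-cell [(K, F)] to the fibres over [A] and [F A]. *)
Definition fibre_functor {C X D Y : Category} {U : Functor C X} {V : Functor D Y}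
    (S : Square U V) (A : X) : Functor (Fibre U A) (Fibre V (lower S A)).
Proof.
  refine {| fobj := @fibre_fobj C X D Y U V S A;
            fmap := @fibre_fmap C X D Y U V S A |};
    intros; apply fibre_hom_ext; simpl; [apply fmap_id | apply fmap_comp].
Defined.

(* [(eps_B)_! ∘ K : C_(G B) -> D_(F (G B)) -> D_B]. *)
Definition fibre_left {C X D Y : Category} {U : Opfibration C X} {V : Opfibration D Y}
    (KF : OpfibredCell U V) {G : Functor Y X} (adj : Adjunction (lower KF) G) (B : Y) :
    Functor (Fibre U (G B)) (Fibre V B) :=
  comp_functor (reindex V (counit adj B)) (fibre_functor KF (G B)).

Arguments fibre_left {C X D Y U V} KF {G} adj B.

(* The cocartesian lifting [K A -> (eps_B)_! (K A)] of [eps_B]. *)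
Definition eps_lift {C X D Y : Category} {U : Opfibration C X} {V : Opfibration D Y}
    (KF : OpfibredCell U V) {G : Functor Y X} (adj : Adjunction (lower KF) G) {B : Y}
    (A : Fibre U (G B)) :
    hom (upper KF (proj1_sig A)) (proj1_sig (fibre_left KF adj B A)) :=
  lift V (counit adj B) (fibre_functor KF (G B) A).

Arguments eps_lift {C X D Y U V} KF {G} adj {B} A.

(* An adjunction [K -| R] is over [F -| G]: [U R = G V] on objects, and
   [V e = eps V]. *)
Definition over_adjunction {C X D Y : Category} {U : Opfibration C X}
    {V : Opfibration D Y} (KF : OpfibredCell U V) {G : Functor Y X}
    (adj : Adjunction (lower KF) G) {R : Functor D C} (a : Adjunction (upper KF) R) :
    Prop :=
  (forall B : D, U (R B) = G (V B)) /\
  (forall B : D, hom_eq (fmap V (counit a B)) (counit adj (V B))).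
Arguments over_adjunction {C X D Y U V} KF {G} adj {R} a.

(* Main.v *)
Require Import Defs.
From Stdlib Require Import Classical ClassicalEpsilon FunctionalExtensionality.
Local Open Scope cat_scope.

(** A right adjoint of [L] is the same thing as a choice, for every object [B], of an
    arrow [e : L A -> B] through which each arrow [L A' -> B] factors uniquely, as
    [e ∘ L g]; such an arrow is called couniversal here. The whole theorem comes
    from one comparison of couniversal arrows ([couniversal_total_to_fibre] and
    [couniversal_fibre_to_total]). Let [eps : F x -> B] be couniversal for [F], let
    [A] lie over [x] and [Z] over [B], and let [u : eps_! (K A) -> Z] be vertical,
    with [e : K A -> Z] its composite with the cocartesian lifting of [eps] at
    [K A]. Then [u] is couniversal for [eps_! K], as a functor between fibres, if
    and only if [e] is couniversal for [K].

    If [e] is couniversal, a vertical [eps_! (K A') -> Z] amounts to an arrow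
    [K A' -> Z] over [eps], which is [e ∘ K g] for a unique [g]; since [eps] is
    couniversal in the base and [e] lies over it, [g] is vertical. Conversely, an
    arrow [f : K A' -> Z] sits over [eps ∘ F h] for a unique [h : U A' -> x]. Let
    [p : A' -> h_! A'] be the cocartesian lifting of [h]. Because [K] preserves
    cocartesian arrows, [f] factors uniquely as [f' ∘ K p] with [f'] over [eps];
    then [f'] factors uniquely through the lifting of [eps] at [K (h_! A')], as a
    vertical arrow [eps_! K (h_! A') -> Z], to which the property of [u] applies.

    Taking for [eps] the components of the counit of [F -| G], right adjoints on
    the fibres yield the couniversal arrows that define [R], and conversely the
    counit of [K -| R] restricts to couniversal arrows in the fibres. The formula
    [e = u ∘ lift] holds by construction in both directions. Two right adjoints of
    one functor are related by a unique isomorphism compatible with the counits,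
    which gives the comparison with an arbitrary [R_Y]. Finally, couniversality of
    the counit of [F -| G] makes base arrows into [G Y] equal as soon as their
    transposes are, so [V e = eps V] forces [U R = G V] on arrows and puts the unit
    of [K -| R] over that of [F -| G]: this is the adjunction in Cat^2. *)

Set Implicit Arguments.
Unset Strict Implicit.
Unset Printing Implicit Defensive.

Local Notation "f ≈ g" := (hom_eq f g) (at level 70).

(* The implicit arguments of [naturality] mention [comp_functor] and [id_functor],
   which have to be unfolded before the equation can match. *)
Local Ltac rewrite_r H :=
  let N := fresh in pose proof H as N; simpl in N |- *; rewrite N; clear N.
Local Ltac rewrite_l H :=
  let N := fresh in pose proof H as N; simpl in N |- *; rewrite <- N; clear N.

(** * Heterogeneous equality of arrows, functors and transformations *)

Lemma hom_eq_dom {C : Category} {A B A' B' : C} (f : hom A B) (g : hom A' B') :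
  f ≈ g -> A = A'.
Proof. now intros []. Qed.

Lemma hom_eq_cod {C : Category} {A B A' B' : C} (f : hom A B) (g : hom A' B') :
  f ≈ g -> B = B'.
Proof. now intros []. Qed.

(** The equalities of objects that [hom_eq_comp] asks for are already contained in
    the two equalities of arrows. *)
Lemma hom_eq_comp_arrows {C : Category} {A1 B1 C1 A2 B2 C2 : C}
    (g1 : hom B1 C1) (f1 : hom A1 B1) (g2 : hom B2 C2) (f2 : hom A2 B2) :
  g1 ≈ g2 -> f1 ≈ f2 -> g1 ∘ f1 ≈ g2 ∘ f2.
Proof.
  intros Hg Hf.
  exact (hom_eq_comp (hom_eq_dom Hf) (hom_eq_dom Hg) (hom_eq_cod Hg) Hg Hf).
Qed.

Lemma functor_ext {C D : Category} (F G : Functor C D) :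
  (forall A, F A = G A) ->
  (forall (A B : C) (f : hom A B), fmap F f ≈ fmap G f) -> F = G.
Proof.
  destruct F as [F0 F1 Fi Fc], G as [G0 G1 Gi Gc]. simpl. intros H0 H1.
  assert (E0 : F0 = G0) by now apply functional_extensionality.
  subst G0.
  assert (E1 : F1 = G1).
  { do 3 (apply functional_extensionality_dep; intro). now apply hom_eq_eq. }
  subst G1. f_equal; apply proof_irrelevance.
Qed.

Lemma nat_trans_ext {C D : Category} {F G : Functor C D} (s t : NatTrans F G) :
  (forall A, s A = t A) -> s = t.
Proof.
  destruct s as [s Hs], t as [t Ht]. simpl. intros H.
  assert (E : s = t) by now apply functional_extensionality_dep.
  subst t. f_equal. apply proof_irrelevance.
Qed.

Lemma square_ob {C X D Y : Category} {U : Functor C X} {V : Functor D Y}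
    (S : Square U V) (A : C) : V (upper S A) = lower S (U A).
Proof. exact (f_equal (fun H : Functor C Y => H A) (square_eq S)). Qed.

Lemma square_hom {C X D Y : Category} {U : Functor C X} {V : Functor D Y}
    (S : Square U V) {A B : C} (f : hom A B) :
  fmap V (fmap (upper S) f) ≈ fmap (lower S) (fmap U f).
Proof. exact (hom_eq_functor f (square_eq S)). Qed.

(** * Right adjoints from couniversal arrows *)

Definition couniversal {C D : Category} (L : Functor C D) {A : C} {B : D}
    (e : hom (L A) B) : Prop :=
  forall (A' : C) (f : hom (L A') B), exists! g : hom A' A, e ∘ fmap L g = f.
Arguments couniversal {C D} L {A B} e.

Lemma couniversal_cancel {C D : Category} {L : Functor C D} {A : C} {B : D}
    {e : hom (L A) B} (He : couniversal L e) {A' : C} (g g' : hom A' A) :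
  e ∘ fmap L g = e ∘ fmap L g' -> g = g'.
Proof.
  intros H. destruct (He A' (e ∘ fmap L g')) as [k [_ Hk]].
  rewrite <- (Hk g H). now apply Hk.
Qed.

(** Cancellation for arrows whose ends agree only up to propositional equality. *)
Lemma couniversal_cancel_hom_eq {C D : Category} {L : Functor C D} {A : C} {B : D}
    {e : hom (L A) B} (He : couniversal L e) {A1 A2 A' : C} {B' : D}
    (e' : hom (L A') B') (g1 : hom A1 A') (g2 : hom A2 A) :
  A1 = A2 -> A' = A -> e' ≈ e ->
  e' ∘ fmap L g1 ≈ e ∘ fmap L g2 -> g1 ≈ g2.
Proof.
  intros <- -> H1 H2.
  assert (E := hom_eq_cod H1). subst B'. apply hom_eq_eq in H1. subst e'.
  apply hom_eq_of_eq, (couniversal_cancel He), hom_eq_eq, H2.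
Qed.

Lemma counit_couniversal {C D : Category} {L : Functor C D} {R : Functor D C}
    (a : Adjunction L R) (B : D) :
  couniversal L (A := R B) (B := B) (counit a B).
Proof.
  intros A f. exists (fmap R f ∘ unit a A). split.
  - rewrite fmap_comp, comp_assoc.
    rewrite_r (naturality (counit a) f).
    rewrite <- comp_assoc. rewrite_r (triangle_l a A). apply comp_id_r.
  - intros g <-. rewrite fmap_comp, <- comp_assoc.
    rewrite_l (naturality (unit a) g).
    rewrite comp_assoc. rewrite_r (triangle_r a B). apply comp_id_l.
Qed.

Arguments counit_couniversal {C D L R} a B.

Section CouniversalAdjunction.

Variables (C D : Category) (L : Functor C D).

Section FromObjects.

Variables (R : D -> C) (e : forall B, hom (L (R B)) B).
Hypothesis He : forall B, couniversal L (e B).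

Definition transpose (A : C) (B : D) (f : hom (L A) B) : hom A (R B) :=
  proj1_sig (constructive_definite_description _ (He f)).

Lemma transposeE (A : C) (B : D) (f : hom (L A) B) : e B ∘ fmap L (transpose f) = f.
Proof. exact (proj2_sig (constructive_definite_description _ (He f))). Qed.

(** Couniversality gives functoriality for free: the action on arrows is the only one
    that makes [e] natural. *)
Definition couniversal_functor : Functor D C.
Proof.
  refine {| fobj := R; fmap := fun B B' f => transpose (f ∘ e B) |}.
  - intros B. apply (couniversal_cancel (@He B)).
    now rewrite transposeE, fmap_id, comp_id_l, comp_id_r.
  - intros B B' B'' g f. apply (couniversal_cancel (@He B'')).
    now rewrite transposeE, fmap_comp, comp_assoc, transposeE,
      <- !comp_assoc, transposeE.
Defined.

Lemma couniversal_functor_natural (B B' : D) (f : hom B B') :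
  e B' ∘ fmap L (fmap couniversal_functor f) = f ∘ e B.
Proof. apply transposeE. Qed.

End FromObjects.

Section FromFunctor.

Variables (R : Functor D C) (e : forall B, hom (L (R B)) B).
Hypothesis e_natural : forall (B B' : D) (f : hom B B'),
  e B' ∘ fmap L (fmap R f) = f ∘ e B.
Hypothesis He : forall B, couniversal L (e B).

Definition couniversal_unit : NatTrans (id_functor C) (comp_functor R L).
Proof.
  refine {| component := fun A => transpose He (id (L A))
                         : hom (id_functor C A) (comp_functor R L A) |}.
  intros A B f. simpl. apply (couniversal_cancel (@He (L B))).
  now rewrite !fmap_comp, !comp_assoc, transposeE, comp_id_l, e_natural,
    <- comp_assoc, transposeE, comp_id_r.
Defined.

Definition couniversal_adjunction : Adjunction L R.
Proof.
  refine {| unit := couniversal_unit;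
            counit := {| component := e : forall B, hom (comp_functor L R B)
                                                        (id_functor D B);
                         naturality := e_natural |} |}.
  - intros A. apply transposeE.
  - intros B. simpl. apply (couniversal_cancel (@He B)).
    now rewrite fmap_comp, comp_assoc, e_natural, <- comp_assoc, transposeE, fmap_id.
Defined.

End FromFunctor.

End CouniversalAdjunction.

(** Both counits are couniversal, so each component of the comparison is the only
    arrow that turns one counit into the other. *)
Lemma right_adjoint_iso_exists_unique {C D : Category} {L : Functor C D}
    {R R' : Functor D C} (a : Adjunction L R) (a' : Adjunction L R') :
  exists! t : NatTrans R R', right_adjoint_iso a a' t.
Proof.
  pose (H := counit_couniversal a).
  pose (H' := counit_couniversal a').
  pose (t := fun B => transpose H' (A := R B) (B := B) (counit a B)).
  pose (s := fun B => transpose H (A := R' B) (B := B) (counit a' B)).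
  assert (Ht : forall B, counit a' B ∘ fmap L (t B) = counit a B)
    by (intros B; apply transposeE).
  assert (Hs : forall B, counit a B ∘ fmap L (s B) = counit a' B)
    by (intros B; apply transposeE).
  assert (nat : forall (A B : D) (f : hom A B), t B ∘ fmap R f = fmap R' f ∘ t A).
  { intros A B f. apply (couniversal_cancel (H' B)).
    rewrite !fmap_comp, !comp_assoc, Ht.
    rewrite_r (naturality (counit a) f).
    rewrite_r (naturality (counit a') f).
    now rewrite <- comp_assoc, Ht. }
  exists {| component := t; naturality := nat |}. split.
  - split; [|exact Ht]. intros B. exists (s B). simpl. split.
    + apply (couniversal_cancel (H B)).
      now rewrite fmap_comp, comp_assoc, Hs, Ht, fmap_id, comp_id_r.
    + apply (couniversal_cancel (H' B)).
      now rewrite fmap_comp, comp_assoc, Ht, Hs, fmap_id, comp_id_r.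
  - intros t' [_ Ht']. apply nat_trans_ext. intros B. simpl.
    apply (couniversal_cancel (H' B)). now rewrite Ht.
Qed.

(** * Factorization through cocartesian arrows *)

(** The universal property of a cocartesian arrow, with the base arrows known only
    up to [hom_eq]. *)
Lemma cocartesian_factor {E B : Category} {U : Functor E B} {A A' A'' : E}
    {p : hom A A'} (Hp : cocartesian U p) (q : hom A A'') {X X' X'' : B}
    (p0 : hom X X') (g : hom X' X'') :
  fmap U p ≈ p0 -> fmap U q ≈ g ∘ p0 ->
  exists r : hom A' A'', fmap U r ≈ g /\ r ∘ p = q.
Proof.
  intros Hp0. revert g. destruct Hp0. intros g Hq. assert (E0 := hom_eq_cod Hq). subst X''.
  destruct (Hp A'' q g (eq_sym (hom_eq_eq Hq))) as [r [[Hr1 Hr2] _]].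
  exists r. split; [now apply hom_eq_of_eq | exact Hr2].
Qed.

Lemma cocartesian_cancel {E B : Category} {U : Functor E B} {A A' A'' : E}
    {p : hom A A'} (Hp : cocartesian U p) (r r' : hom A' A'') :
  fmap U r ≈ fmap U r' -> r ∘ p = r' ∘ p -> r = r'.
Proof.
  intros H0 H. apply hom_eq_eq in H0.
  destruct (Hp A'' (r' ∘ p) (fmap U r')) as [k [_ Hk]].
  { now rewrite fmap_comp. }
  rewrite <- (Hk r (conj H0 H)). now apply Hk.
Qed.

(** Arrows over [f] out of [A] are vertical arrows out of [f_! A]. *)
Lemma lift_factor {E B : Category} (P : Opfibration E B) {X X' : B} (f : hom X X')
    (A : Fibre P X) (Z : Fibre P X') (q : hom (proj1_sig A) (proj1_sig Z)) :
  fmap P q ≈ f ->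
  exists v : @hom (Fibre P X') (push P f A) Z, proj1_sig v ∘ lift P f A = q.
Proof.
  intros Hq.
  destruct (cocartesian_factor (lift_cocartesian (f := f) (A := A)) (q := q)
    (p0 := f) (g := id X')) as [r [Hr1 Hr2]].
  - apply lift_over.
  - now rewrite comp_id_l.
  - now exists (exist _ r Hr1).
Qed.

Lemma lift_cancel {E B : Category} (P : Opfibration E B) {X X' : B} (f : hom X X')
    (A : Fibre P X) (Z : Fibre P X') (v v' : @hom (Fibre P X') (push P f A) Z) :
  proj1_sig v ∘ lift P f A = proj1_sig v' ∘ lift P f A -> v = v'.
Proof.
  intros H. apply fibre_hom_ext.
  apply (cocartesian_cancel (lift_cocartesian (f := f) (A := A))); [|exact H].
  exact (hom_eq_trans (proj2_sig v) (hom_eq_sym (proj2_sig v'))).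
Qed.

Lemma fibre_comp_lift_over {E B : Category} (P : Opfibration E B) {X X' : B}
    (f : hom X X') (A : Fibre P X) (Z : Fibre P X')
    (v : @hom (Fibre P X') (push P f A) Z) :
  fmap P (proj1_sig v ∘ lift P f A) ≈ f.
Proof.
  rewrite fmap_comp. apply hom_eq_trans with (g := id X' ∘ f).
  - apply hom_eq_comp_arrows; [exact (proj2_sig v) | apply lift_over].
  - apply hom_eq_of_eq, comp_id_l.
Qed.

(** * Couniversal arrows in a fibre and in the total category *)

Section FibrewiseCouniversal.

Variables (C X D Y : Category) (U : Opfibration C X) (V : Opfibration D Y).
Variables (KF : OpfibredCell U V) (x : X) (B : Y) (eps : hom (lower KF x) B).
Hypothesis Heps : couniversal (lower KF) eps.

Let K := upper KF.
Let L : Functor (Fibre U x) (Fibre V B) :=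
  comp_functor (reindex V eps) (fibre_functor KF x).
Let l (A : Fibre U x) : hom (K (proj1_sig A)) (proj1_sig (L A)) :=
  lift V eps (fibre_functor KF x A).

Lemma fibrewise_lift_natural (A A' : Fibre U x) (w : hom A A') :
  proj1_sig (fmap L w) ∘ l A = l A' ∘ fmap K (proj1_sig w).
Proof. exact (reindex_fmapE eps (fmap (fibre_functor KF x) w)). Qed.

Lemma fibrewise_comp_lift_over (A : Fibre U x) (Z : Fibre V B) (v : hom (L A) Z) :
  fmap V (proj1_sig v ∘ l A) ≈ eps.
Proof. exact (fibre_comp_lift_over (A := fibre_functor KF x A) v). Qed.

Variables (A : Fibre U x) (Z : Fibre V B) (u : hom (L A) Z).
Let e : hom (K (proj1_sig A)) (proj1_sig Z) := proj1_sig u ∘ l A.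

Lemma comp_lift_fmap (A' : Fibre U x) (w : hom A' A) :
  proj1_sig (u ∘ fmap L w) ∘ l A' = e ∘ fmap K (proj1_sig w).
Proof.
  unfold e. simpl. rewrite <- !comp_assoc. f_equal. apply fibrewise_lift_natural.
Qed.

(** [e] lies over [eps], so the base component of a factorization through [e] is
    forced. *)
Lemma factor_over {A' : C} (g : hom A' (proj1_sig A)) {x' : X} (h : hom x' x) :
  U A' = x' -> fmap V (e ∘ fmap K g) ≈ eps ∘ fmap (lower KF) h -> fmap U g ≈ h.
Proof.
  intros E H.
  destruct (hom_eq_cast (A' := lower KF (U (proj1_sig A))) (B' := B) eps)
    as [eps' Heps'].
  { now rewrite (proj2_sig A). }
  { reflexivity. }
  apply (couniversal_cancel_hom_eq Heps (e' := eps')); auto.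
  - exact (proj2_sig A).
  - apply hom_eq_trans with (2 := H). rewrite fmap_comp. apply hom_eq_sym.
    apply hom_eq_comp_arrows.
    + apply hom_eq_trans with (2 := hom_eq_sym Heps'). apply fibrewise_comp_lift_over.
    + apply (square_hom KF g).
Qed.

(** Factoring an arrow over [eps] through [e] yields an arrow over the identity, by
    [factor_over], so the factorization takes place in the fibre. *)
Lemma couniversal_total_to_fibre : couniversal K e -> couniversal L u.
Proof.
  intros He A' v.
  destruct (He _ (proj1_sig v ∘ l A')) as [g [Hg _]].
  assert (Hv : fmap U g ≈ id x).
  { apply factor_over; [exact (proj2_sig A')|].
    rewrite Hg, fmap_id, comp_id_r. apply fibrewise_comp_lift_over. }
  exists (exist _ g Hv : hom A' A). split.
  - apply lift_cancel. etransitivity; [apply comp_lift_fmap | exact Hg].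
  - intros w Hw. apply fibre_hom_ext. simpl. apply (couniversal_cancel He).
    rewrite Hg, <- Hw. apply comp_lift_fmap.
Qed.

(** An arrow out of [K A'] is first pushed along the cocartesian lifting [p] of the
    transpose [h] of its base component, which brings its domain into the image of
    the fibre over [x]; preservation of cocartesian arrows by [K] makes this
    reversible. *)
Lemma couniversal_fibre_to_total : couniversal L u -> couniversal K e.
Proof.
  intros Hu A' f.
  destruct (hom_eq_cast (A' := lower KF (U A')) (B' := B) (fmap V f)) as [f0 Hf0].
  { exact (square_ob KF A'). }
  { exact (proj2_sig Z). }
  (* The base component of [f] is [eps ∘ F h]. *)
  destruct (Heps f0) as [h [Hh _]].
  pose (A0 := exist _ A' eq_refl : Fibre U (U A')).
  pose (p := lift U h A0 : hom A' (proj1_sig (push U h A0))).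
  assert (Hp : fmap U p ≈ h) by exact (lift_over h A0).
  assert (HKp : fmap V (fmap K p) ≈ fmap (lower KF) h).
  { exact (hom_eq_trans (square_hom KF p) (hom_eq_fmap (lower KF) Hp)). }
  assert (Cp : cocartesian U p) by exact (lift_cocartesian (f := h) (A := A0)).
  assert (CKp : cocartesian V (fmap K p)) by exact (opf_preserves Cp).
  (* [f = f' ∘ K p] with [f'] over [eps], then [f' = v ∘ l (h_! A')] with [v]
     vertical, and finally [v = u ∘ L w]; the factorization of [f] is [w ∘ p]. *)
  destruct (cocartesian_factor CKp (q := f) HKp (g := eps)) as [f' [Hf'1 Hf'2]].
  { rewrite Hh. now apply hom_eq_sym. }
  destruct (lift_factor (f := eps) (A := fibre_functor KF x (push U h A0)) (Z := Z)
    (q := f') Hf'1) as [v Hv].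
  destruct (Hu _ v) as [w [Hw Hwu]].
  exists (proj1_sig w ∘ p). split.
  - rewrite fmap_comp, comp_assoc, <- comp_lift_fmap, Hw.
    etransitivity; [|exact Hf'2]. f_equal. exact Hv.
  - intros g Hg.
    (* Any other [g] also lies over [h], so it is [w' ∘ p] with [w'] vertical;
       cancelling [K p] and the lifting of [eps] brings back the uniqueness of [w]. *)
    assert (Hgh : fmap U g ≈ h).
    { apply factor_over; [reflexivity|]. rewrite Hg, Hh. now apply hom_eq_sym. }
    destruct (cocartesian_factor Cp (q := g) Hp (g := id x)) as [w' [Hw'1 Hw'2]].
    { now rewrite comp_id_l. }
    pose (w1 := exist _ w' Hw'1 : @hom (Fibre U x) (push U h A0) A).
    rewrite <- Hw'2. f_equal. change w' with (proj1_sig w1). f_equal.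
    apply Hwu, lift_cancel.
    transitivity (e ∘ fmap K w'); [exact (comp_lift_fmap w1)|].
    transitivity f'; [|now symmetry].
    apply (cocartesian_cancel CKp).
    + apply hom_eq_trans with (2 := hom_eq_sym Hf'1).
      change w' with (proj1_sig w1). rewrite <- comp_lift_fmap. apply fibrewise_comp_lift_over.
    + now rewrite Hf'2, <- comp_assoc, <- fmap_comp, Hw'2.
Qed.

End FibrewiseCouniversal.

(** * Adjunctions over an adjunction of the bases *)

Section OverAdjunction.

Variables (C X D Y : Category) (U : Opfibration C X) (V : Opfibration D Y).
Variables (KF : OpfibredCell U V) (G : Functor Y X) (adj : Adjunction (lower KF) G).

Section FromTotal.

Variables (R : Functor D C) (a : Adjunction (upper KF) R).
Hypothesis Ha : over_adjunction KF adj a.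

(** Base arrows into [G y] are determined by their transposes, and the transpose of
    [U g] can be read off in the total category because the counit of [K -| R] lies
    over that of [F -| G]. *)
Lemma over_counit_transpose {A : C} {B : D} {y : Y} (g : hom A (R B))
    {x : X} (h : hom x (G y)) :
  U A = x -> V B = y ->
  fmap V (counit a B ∘ fmap (upper KF) g) ≈ counit adj y ∘ fmap (lower KF) h ->
  fmap U g ≈ h.
Proof.
  intros E <- H. destruct Ha as [Hob Hc].
  destruct (hom_eq_cast (A' := lower KF (U (R B))) (B' := V B) (counit adj (V B)))
    as [e' He'].
  { simpl. now rewrite Hob. }
  { reflexivity. }
  apply (couniversal_cancel_hom_eq (counit_couniversal adj (V B)) (e' := e')); auto.
  apply hom_eq_trans with (2 := H). rewrite fmap_comp. apply hom_eq_sym.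
  apply hom_eq_comp_arrows.
  - exact (hom_eq_trans (Hc B) (hom_eq_sym He')).
  - exact (square_hom KF g).
Qed.

(** Equality on objects is part of [over_adjunction]. On an arrow [f], both sides
    have transpose [V f ∘ eps], by naturality of the two counits. *)
Lemma over_square : comp_functor U R = comp_functor G V.
Proof.
  pose proof Ha as [Hob Hc]. apply functor_ext; [exact Hob|].
  intros A B f. simpl. apply over_counit_transpose; [apply Hob | reflexivity |].
  rewrite_r (naturality (counit a) f).
  rewrite_r (naturality (counit adj) (fmap V f)).
  rewrite fmap_comp. apply hom_eq_comp_arrows; [constructor | apply Hc].
Qed.

(** By the triangle identities both sides have an identity as transpose. *)
Lemma over_unit (A : C) : fmap U (unit a A) ≈ unit adj (U A).
Proof.
  apply over_counit_transpose; [reflexivity | exact (square_ob KF A) |].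
  rewrite_r (triangle_l a A). rewrite_r (triangle_l adj (U A)).
  rewrite fmap_id. apply hom_eq_id. exact (square_ob KF A).
Qed.

Variable HRG : comp_functor U R = comp_functor G V.
Let RG : Square V U := {| upper := R; lower := G; square_eq := HRG |}.

Lemma over_square_adjunction :
  exists A : SquareAdjunction KF RG,
    upper_cell (sq_counit A) = counit a /\ lower_cell (sq_counit A) = counit adj.
Proof.
  pose (eta := @Build_SquareCell _ _ _ _ _ _ (id_square U) (comp_square RG KF)
    (unit a) (unit adj) over_unit).
  pose (eps := @Build_SquareCell _ _ _ _ _ _ (comp_square KF RG) (id_square V)
    (counit a) (counit adj) (proj2 Ha)).
  unshelve eexists.
  { refine {| sq_unit := eta; sq_counit := eps |}; simpl;
      first [apply triangle_l | apply triangle_r]. }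
  now split.
Qed.

(** The counit on fibres is the vertical part of the counit of [K -| R]. *)
Lemma over_restriction (B : Y) :
  exists aB : Adjunction (fibre_left KF adj B) (fibre_functor RG B),
    forall E : Fibre V B,
      counit a (proj1_sig E)
        = proj1_sig (counit aB E) ∘ eps_lift KF adj (fibre_functor RG B E).
Proof.
  assert (H : forall E : Fibre V B, exists u :
    @hom (Fibre V B) (fibre_left KF adj B (fibre_functor RG B E)) E,
    proj1_sig u ∘ eps_lift KF adj (fibre_functor RG B E) = counit a (proj1_sig E)).
  { intros E. apply lift_factor. destruct E as [E []]. exact (proj2 Ha E). }
  pose (u := fun E => proj1_sig (constructive_indefinite_description _ (H E))).
  assert (Hu : forall E, proj1_sig (u E) ∘ eps_lift KF adj (fibre_functor RG B E)
      = counit a (proj1_sig E)).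
  { intros E. exact (proj2_sig (constructive_indefinite_description _ (H E))). }
  clearbody u.
  assert (nat : forall (E E' : Fibre V B) (f : hom E E'),
    u E' ∘ fmap (fibre_left KF adj B) (fmap (fibre_functor RG B) f) = f ∘ u E).
  { intros E E' f. apply lift_cancel.
    etransitivity; [apply comp_lift_fmap|]. simpl.
    etransitivity; [exact (f_equal (fun k => k ∘ _) (Hu E'))|].
    rewrite <- comp_assoc.
    etransitivity; [|exact (f_equal (comp (proj1_sig f)) (eq_sym (Hu E)))].
    exact (naturality (counit a) (proj1_sig f)). }
  assert (He : forall E, couniversal (fibre_left KF adj B) (u E)).
  { intros E. apply couniversal_total_to_fibre; [apply counit_couniversal|].
    pose proof (counit_couniversal a (proj1_sig E)) as Hc.
    change (couniversal (upper KF) (A := R (proj1_sig E))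
      (proj1_sig (u E) ∘ eps_lift KF adj (fibre_functor RG B E))).
    rewrite Hu. exact Hc. }
  exists (couniversal_adjunction nat He). intros E. symmetry. apply Hu.
Qed.

End FromTotal.

(** Each object [E] is placed in its own fibre, over [V E] strictly, so that the value
    of [R] at [E] is [R_(V E) E], with counit [u ∘ lift]. *)
Lemma over_adjunction_of_fibrewise :
  (forall B : Y, exists RB : Functor (Fibre V B) (Fibre U (G B)),
     inhabited (Adjunction (fibre_left KF adj B) RB)) ->
  exists (R : Functor D C) (a : Adjunction (upper KF) R), over_adjunction KF adj a.
Proof.
  intros H.
  (* The object and its couniversal arrow are chosen together, as the fibrewise
     adjoints are only known to exist. *)
  assert (H' : forall E : D, exists p : {A : Fibre U (G (V E)) &
    @hom (Fibre V (V E)) (fibre_left KF adj (V E) A) (exist _ E eq_refl)},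
    couniversal (fibre_left KF adj (V E)) (projT2 p)).
  { intros E. destruct (H (V E)) as [RB [b]].
    exists (existT _ (RB (exist _ E eq_refl)) (counit b (exist _ E eq_refl))).
    apply counit_couniversal. }
  pose (p := fun E => proj1_sig (constructive_indefinite_description _ (H' E))).
  pose (A := fun E => projT1 (p E)).
  pose (u := fun E => projT2 (p E)).
  assert (Hu : forall E, couniversal (fibre_left KF adj (V E)) (u E)).
  { intros E. exact (proj2_sig (constructive_indefinite_description _ (H' E))). }
  pose (e := fun E => proj1_sig (u E) ∘ eps_lift KF adj (A E)
    : hom (upper KF (proj1_sig (A E))) E).
  assert (He : forall E, couniversal (upper KF) (e E)).
  { intros E. exact (couniversal_fibre_to_total (counit_couniversal adj (V E)) (Hu E)). }
  exists (couniversal_functor He).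
  exists (couniversal_adjunction (couniversal_functor_natural He) He).
  split.
  - intros E. exact (proj2_sig (A E)).
  - intros E. exact (fibre_comp_lift_over (u E)).
Qed.

End OverAdjunction.

Theorem corollary3p4 (C X D Y : Category) (U : Opfibration C X) (V : Opfibration D Y)
    (KF : OpfibredCell U V) (G : Functor Y X) (adj : Adjunction (lower KF) G) :
  ((exists (R : Functor D C) (a : Adjunction (upper KF) R), over_adjunction KF adj a)
   <->
   (forall B : Y, exists RB : Functor (Fibre V B) (Fibre U (G B)),
      inhabited (Adjunction (fibre_left KF adj B) RB)))
  /\
  forall (R : Functor D C) (a : Adjunction (upper KF) R), over_adjunction KF adj a ->
    exists HRG : comp_functor U R = comp_functor G V,
    let RG : Square V U := {| upper := R; lower := G; square_eq := HRG |} in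
    (forall B : Y,
       exists aB : Adjunction (fibre_left KF adj B) (fibre_functor RG B),
       (forall E : Fibre V B,
          counit a (proj1_sig E)
            = proj1_sig (counit aB E) ∘ eps_lift KF adj (fibre_functor RG B E))
       /\
       forall (RB : Functor (Fibre V B) (Fibre U (G B)))
              (b : Adjunction (fibre_left KF adj B) RB),
         exists t : NatTrans RB (fibre_functor RG B),
         unique (right_adjoint_iso b aB) t
         /\
         forall E : Fibre V B,
           counit a (proj1_sig E) ∘ fmap (upper KF) (proj1_sig (t E))
             = proj1_sig (counit b E) ∘ eps_lift KF adj (RB E))
    /\
    exists A : SquareAdjunction KF RG,
      upper_cell (sq_counit A) = counit a /\ lower_cell (sq_counit A) = counit adj.
Proof.
  split.
  - split; [|apply over_adjunction_of_fibrewise].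
    intros (R & a & Ha) B.
    destruct (over_restriction Ha (over_square Ha) B) as [aB _]. eauto.
  - intros R a Ha. exists (over_square Ha). intros RG.
    split; [|now apply over_square_adjunction].
    intros B. destruct (over_restriction Ha (over_square Ha) B) as [aB HaB].
    exists aB. split; [exact HaB|]. intros RB b.
    destruct (right_adjoint_iso_exists_unique b aB) as [t Ht].
    exists t. split; [exact Ht|]. intros E.
    destruct Ht as [[_ Ht] _].
    rewrite <- Ht. symmetry. rewrite HaB. apply comp_lift_fmap.
Qed.
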